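(* Let $r\ge 3$ and $s\ge 3$ both be odd integers. Then $$ac(T_{r,s})\ge\left\lceil\frac{r+s-6}{4}\right\rceil\left(\frac{rs-1}{2}\right).$$
   Context: $T_{r,s}=C_r\square C_s$ is the toroidal grid, the Cartesian product of the cycles on $r$ and $s$ vertices: vertices are pairs $(i,j)$ with $0\le i\le r-1$, $0\le j\le s-1$, and two vertices are adjacent iff they agree in one coordinate and the other coordinates are adjacent in the corresponding cycle. For a connected graph $G$ with diameter $d\ge 2$ and graph distance $d(u,v)$, an antipodal coloring is a map $g$ from $V(G)$ to the non-negative integers with $|g(u)-g(v)|\ge d-d(u,v)$ for all distinct vertices $u,v$. The span of $g$ is the largest integer assigned by $g$, and the antipodal number $ac(G)$ is the minimum span among all antipodal colorings of $G$. *)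

(* Defs.v *)
From mathcomp Require Import all_boot all_order all_algebra.

Set Implicit Arguments.
Unset Strict Implicit.
Unset Printing Implicit Defensive.

(* A simple graph on a finite vertex type T is given by its (symmetric,        *)
(* irreflexive) adjacency relation e : rel T.                                  *)
Section Graph.
Variables (T : finType) (e : rel T).
Implicit Types (x y u v : T) (n : nat) (g : T -> nat).

Definition has_walk x y n : bool :=
  [exists p : n.-tuple T, path e x p && (last x p == y)].

(* A shortest walk repeats no vertex, so it has length < #|T|; the junk value  *)
(* #|T| is returned when x and y lie in different components.                  *)
Definition gdist x y : nat := find (has_walk x y) (iota 0 #|T|).

Definition diameter : nat := \max_(x : T) \max_(y : T) gdist x y.

(* The truncated subtraction is harmless: gdist u v <= diameter, and the       *)
(* absolute difference `|g u - g v| is nonnegative anyway.                     *)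
Definition antipodal_coloring g : bool :=
  [forall u, forall v, (u != v) ==>
    (diameter - gdist u v <= `|g u - g v|)].

Definition coloring_span g : nat := \max_(v : T) g v.

(* A coloring of span n takes its values in {0, ..., n}, whence the finite     *)
(* search space.                                                               *)
Definition antipodal_span n : bool :=
  [exists g : {ffun T -> 'I_n.+1},
     antipodal_coloring (fun v => nat_of_ord (g v)) && (coloring_span (fun v => nat_of_ord (g v)) == n)].

Lemma antipodal_spanP n :
  reflect (exists2 g, antipodal_coloring g & coloring_span g = n) (antipodal_span n).
Proof.
apply: (iffP existsP) => [[g /andP[gA /eqP gn]] | [g gA gn]].
  by exists (fun v => nat_of_ord (g v)).
have gE v : ([ffun v => inord (g v)] : {ffun T -> 'I_n.+1}) v = g v :> nat.
  by rewrite ffunE inordK // ltnS -gn /coloring_span (leq_bigmax v).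
exists [ffun v => inord (g v)]; apply/andP; split.
  apply/forallP => u; apply/forallP => v /=; rewrite !gE.
  by have /forallP/(_ u)/forallP/(_ v) := gA.
by apply/eqP; rewrite -[RHS]gn; apply: eq_bigr => v _; rewrite /= gE.
Qed.

Lemma antipodal_span_exists : exists n, antipodal_span n.
Proof.
pose g v := (diameter * enum_rank v)%N.
exists (coloring_span g); apply/antipodal_spanP; exists g => //.
apply/forallP => u; apply/forallP => v; apply/implyP => uv.
apply: leq_trans (leq_subr _ _) _.
rewrite /g !PoszM -GRing.mulrBr abszM absz_nat leq_pmulr // absz_gt0.
rewrite GRing.subr_eq0; apply: contra uv => /eqP [] h.
by apply/eqP/enum_rank_inj/val_inj.
Qed.

Definition antipodal_number : nat := ex_minn antipodal_span_exists.

Lemma antipodal_numberP :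
  (exists2 g, antipodal_coloring g & coloring_span g = antipodal_number) /\
  (forall g, antipodal_coloring g -> antipodal_number <= coloring_span g).
Proof.
rewrite /antipodal_number; case: ex_minnP => n /antipodal_spanP h hmin.
by split=> // g gA; apply/hmin/antipodal_spanP; exists g.
Qed.

End Graph.

(* ordS i is i + 1 mod n; this is a simple cycle for n >= 3.                   *)
Definition cycle_graph (n : nat) : rel 'I_n :=
  fun i j => (j == ordS i) || (i == ordS j).

Definition cartesian_product (T1 T2 : finType) (e1 : rel T1) (e2 : rel T2) :
    rel (T1 * T2) :=
  fun u v => ((u.1 == v.1) && e2 u.2 v.2) || ((u.2 == v.2) && e1 u.1 v.1).

Definition toroidal_grid (r s : nat) : rel ('I_r * 'I_s) :=
  cartesian_product (@cycle_graph r) (@cycle_graph s).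

(* Main.v *)
Require Import Defs.
From mathcomp Require Import all_boot all_order all_algebra.
From mathcomp Require Import zify.

Import Order.TTheory GRing.Theory Num.Theory.
Local Open Scope ring_scope.

(** Three vertices on a cycle of length [n] cut it into three arcs, so their
    three pairwise distances add up to at most [n]; on the torus, where the
    distances of the two coordinates add up, the three pairwise distances add
    up to at most [r + s].  As the diameter is [d = (r + s - 2) / 2], the
    antipodal condition for the three pairs gives
    [2 (max - min) >= 3 d - (r + s) = (r + s - 6) / 2]
    for the colours of any three distinct vertices.  So three distinct vertices
    never have all their colours in one block of
    [c = ceil ((r + s - 6) / 4)] consecutive integers.  If all colours
    were below [c (r s - 1) / 2], they would occupy [(r s - 1) / 2] such
    blocks, with at most two vertices each: too few for [r s] vertices
    ([card_le_of_sparse_blocks]).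

    The distances only have to be estimated in one direction each: an explicit
    walk bounds every distance from above ([toroidal_gdist_le]), and a
    1-Lipschitz function bounds one particular distance, hence the diameter,
    from below ([toroidal_diameter_ge]). *)

Local Open Scope nat_scope.

(** * Walks and distances *)

Section Walks.
Context {T : finType} {e : rel T}.

Lemma has_walkP x y n :
  reflect (exists p, [/\ size p = n, path e x p & last x p = y])
          (has_walk e x y n).
Proof.
apply: (iffP existsP) => [[p /andP[ep /eqP py]]|[p [sp ep py]]].
  by exists p; rewrite size_tuple.
have sp' : size p == n by apply/eqP.
by exists (Tuple sp'); rewrite /= ep py eqxx.
Qed.

Lemma has_walk_refl x : has_walk e x x 0.
Proof. by apply/has_walkP; exists [::]. Qed.

Lemma has_walk_cat {x y z m n} :
  has_walk e x y m -> has_walk e y z n -> has_walk e x z (m + n).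
Proof.
move=> /has_walkP[p [sp ep py]] /has_walkP[q [sq eq qz]].
apply/has_walkP; exists (p ++ q).
by rewrite size_cat sp sq cat_path ep last_cat py.
Qed.

Lemma has_walk_edge x y : e x y -> has_walk e x y 1.
Proof. by move=> exy; apply/has_walkP; exists [:: y]; rewrite /= exy. Qed.

Lemma has_walk_sym x y n :
  symmetric e -> has_walk e x y n -> has_walk e y x n.
Proof.
move=> sym_e /has_walkP[p [sp ep py]]; apply/has_walkP.
exists (rev (belast x p)); rewrite size_rev size_belast sp.
split=> //; last first.
  by case: p py {sp ep} => //= z p _; rewrite rev_cons last_rcons.
by rewrite -py rev_path (eq_path (e' := e)) // => u v /=; rewrite sym_e.
Qed.

(** Walks of length [#|T|] or more need no separate treatment because
    [gdist] never exceeds [#|T|]. *)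
Lemma gdist_le_walk x y n : has_walk e x y n -> gdist e x y <= n.
Proof.
move=> wn; rewrite leqNgt; apply/negP => lt_n.
have n_card : n < #|T|.
  by apply: leq_trans lt_n _; rewrite -[leqRHS](size_iota 0) find_size.
by have := before_find 0 lt_n; rewrite nth_iota // add0n wn.
Qed.

Lemma lipschitz_walk (f : T -> nat) x y n :
    (forall u v, e u v -> f v <= f u + 1) ->
  has_walk e x y n -> f y <= f x + n.
Proof.
move=> lip /has_walkP[p [<- ep <-]].
elim: p x ep => [|z p IHp] x /=; first by rewrite addn0.
by case/andP => /lip fz /IHp; lia.
Qed.

(** The hypothesis [k <= #|T|] accounts for the value [#|T|] that [gdist]
    takes on disconnected pairs. *)
Lemma lipschitz_le_gdist (f : T -> nat) x y k :
    (forall u v, e u v -> f v <= f u + 1) -> k <= #|T| ->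
  f x + k <= f y -> k <= gdist e x y.
Proof.
move=> lip k_card fxy; rewrite leqNgt; apply/negP => lt_k.
have lt_card : gdist e x y < #|T| by apply: leq_trans lt_k k_card.
have : has (has_walk e x y) (iota 0 #|T|) by rewrite has_find size_iota.
move=> /(nth_find 0); rewrite -/(gdist e x y) nth_iota // add0n.
by move=> /(lipschitz_walk _ _ _ _ lip); lia.
Qed.

Lemma gdist_le_diameter x y : gdist e x y <= diameter e.
Proof.
apply: leq_trans (leq_bigmax x).
exact: (leq_bigmax (F := fun y => gdist e x y) y).
Qed.

End Walks.

Lemma has_walk_map {T1 T2 : finType} {e1 : rel T1} {e2 : rel T2} (h : T1 -> T2)
    x y n :
    (forall u v, e1 u v -> e2 (h u) (h v)) ->
  has_walk e1 x y n -> has_walk e2 (h x) (h y) n.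
Proof.
move=> he /has_walkP[p [sp ep py]]; apply/has_walkP; exists (map h p).
rewrite size_map last_map py sp; split=> //.
by rewrite path_map; apply: sub_path ep => u v; apply: he.
Qed.

(** * Distances on cycles and toroidal grids *)

(** Truncated subtraction makes [(i - j) + (j - i)] the absolute difference. *)
Definition cyclic_dist n i j :=
  minn ((i - j) + (j - i)) (n - ((i - j) + (j - i))).

(** Each distance is at most the length of the arc between the two points that
    avoids the third, and these three arcs make up the cycle. *)
Lemma cyclic_dist_triangle_perimeter n i j k : i < n -> j < n -> k < n ->
  cyclic_dist n i j + cyclic_dist n j k + cyclic_dist n i k <= n.
Proof. rewrite /cyclic_dist; lia. Qed.

Lemma cycle_graph_sym n : symmetric (@cycle_graph n).
Proof. by move=> i j; rewrite /cycle_graph orbC. Qed.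

Lemma val_iter_ordS n (i : 'I_n) k : iter k (@ordS n) i = (i + k) %% n :> nat.
Proof.
elim: k => [|k IHk] /=; first by rewrite addn0 modn_small.
by rewrite IHk -addn1 modnDml addn1 addnS.
Qed.

Lemma cycle_walk_iter_ordS n (i : 'I_n) k :
  has_walk (@cycle_graph n) i (iter k (@ordS n) i) k.
Proof.
elim: k => [|k IHk]; first exact: has_walk_refl.
rewrite -addn1; apply: has_walk_cat IHk _.
by apply: has_walk_edge; rewrite addn1 /= /cycle_graph eqxx.
Qed.

Lemma cycle_walk n (i j : 'I_n) :
  has_walk (@cycle_graph n) i j (cyclic_dist n i j).
Proof.
wlog le_ij : i j / i <= j.
  move=> IH; case: (leqP i j) => [/IH //|/ltnW /IH].
  by rewrite /cyclic_dist addnC => /(has_walk_sym _ _ _ (@cycle_graph_sym n)).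
have [lt_i lt_j] := (ltn_ord i, ltn_ord j).
(* The two arcs between [i] and [j] are walked in the direction of [ordS]. *)
have fwd : has_walk (@cycle_graph n) i j (j - i).
  have := cycle_walk_iter_ordS n i (j - i); congr has_walk.
  by apply: val_inj; rewrite /= val_iter_ordS subnKC // modn_small.
have bwd : has_walk (@cycle_graph n) i j (n - (j - i)).
  apply/has_walk_sym; first exact: cycle_graph_sym.
  have := cycle_walk_iter_ordS n j (n - (j - i)); congr has_walk.
  apply: val_inj; rewrite /= val_iter_ordS.
  have -> : j + (n - (j - i)) = i + n by lia.
  by rewrite modnDr modn_small.
rewrite /cyclic_dist (_ : i - j + (j - i) = j - i); last by lia.
by rewrite /minn; case: ifP.
Qed.

Lemma toroidal_gdist_le r s (u v : 'I_r * 'I_s) :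
  gdist (@toroidal_grid r s) u v
    <= cyclic_dist r u.1 v.1 + cyclic_dist s u.2 v.2.
Proof.
case: u v => [i j] [i' j'] /=; apply: gdist_le_walk.
apply: (has_walk_cat (y := (i', j))).
  apply: (has_walk_map (fun k => (k, j)) _ _ _ _ (cycle_walk r i i')) => k l kl.
  by rewrite /toroidal_grid /cartesian_product /= eqxx kl orbT.
apply: (has_walk_map (fun k => (i', k)) _ _ _ _ (cycle_walk s j j')) => k l kl.
by rewrite /toroidal_grid /cartesian_product /= eqxx kl.
Qed.

Lemma toroidal_gdist_triangle_perimeter r s (u v w : 'I_r * 'I_s) :
  gdist (@toroidal_grid r s) u v + gdist (@toroidal_grid r s) v w
    + gdist (@toroidal_grid r s) u w <= r + s.
Proof.
have := cyclic_dist_triangle_perimeter r u.1 v.1 w.1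
  (ltn_ord _) (ltn_ord _) (ltn_ord _).
have := cyclic_dist_triangle_perimeter s u.2 v.2 w.2
  (ltn_ord _) (ltn_ord _) (ltn_ord _).
have := toroidal_gdist_le r s u v; have := toroidal_gdist_le r s v w.
have := toroidal_gdist_le r s u w; lia.
Qed.

Lemma cyclic_dist0_lipschitz n (i j : 'I_n) :
  cycle_graph i j -> cyclic_dist n 0 j <= cyclic_dist n 0 i + 1.
Proof.
have [lt_i lt_j] := (ltn_ord i, ltn_ord j).
have ordSE (k : 'I_n) : ordS k = (if k.+1 == n then 0 else k.+1) :> nat.
  case: eqP => [kn|kn] /=; first by rewrite kn modnn.
  by rewrite modn_small //; have := ltn_ord k; lia.
rewrite /cyclic_dist => /orP[] /eqP/(congr1 (@nat_of_ord n)).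
  by rewrite ordSE; case: ifP; lia.
by rewrite ordSE; case: ifP; lia.
Qed.

(** The vertices [(0, 0)] and [(r./2, s./2)] are this far apart: the sum of the
    cyclic distances of both coordinates to 0 is zero at the former, is
    [r./2 + s./2] at the latter, and grows by at most 1 along an edge. *)
Lemma toroidal_diameter_ge r s : 0 < r -> 0 < s ->
  r./2 + s./2 <= diameter (@toroidal_grid r s).
Proof.
move=> r_gt0 s_gt0.
have r2 : r./2 < r by lia.
have s2 : s./2 < s by lia.
apply: leq_trans (gdist_le_diameter (Ordinal r_gt0, Ordinal s_gt0)
                                    (Ordinal r2, Ordinal s2)).
pose f (u : 'I_r * 'I_s) := cyclic_dist r 0 u.1 + cyclic_dist s 0 u.2.
apply: (lipschitz_le_gdist f).
- move=> [i j] [i' j']; rewrite /f => /orP[] /andP[/= /eqP->].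
    by rewrite -addnA leq_add2l; apply: cyclic_dist0_lipschitz.
  by rewrite addnAC leq_add2r; apply: cyclic_dist0_lipschitz.
- rewrite card_prod !card_ord; nia.
- rewrite /f /cyclic_dist /=; lia.
Qed.

(** * Blocks of colours *)

(** Pigeonhole principle: integer division by [c] sends the colours below
    [m * c] to [m] blocks of [c] consecutive values. *)
Lemma card_le_of_sparse_blocks (T : finType) (g : T -> nat) c m k :
    (forall b, #|[set v | g v %/ c == b]| <= k) ->
  (forall v, g v < m * c) -> #|T| <= m * k.
Proof.
move=> sparse g_lt.
have block_lt v : g v %/ c < m.
  by rewrite ltn_divLR //; case: c g_lt {sparse} => // /(_ v); rewrite muln0.
pose block v : 'I_m := Ordinal (block_lt v).
rewrite -sum1_card (partition_big block xpredT) //=.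
have -> : m * k = \sum_(b < m) k by rewrite sum_nat_const card_ord.
apply: leq_sum => b _.
rewrite sum1_card; apply: leq_trans (sparse b).
by apply/subset_leq_card/subsetP => v; rewrite !inE.
Qed.

(** The colours of three vertices in one block have pairwise differences of
    sum at most [2 * (c - 1)], whereas the antipodal condition makes this sum
    at least [(r + s - 6) / 2], which is larger. *)
Lemma antipodal_coloring_sparse r s (g : 'I_r * 'I_s -> nat) c b :
    odd r -> odd s -> 0 < c -> 4 * c < r + s - 2 ->
    antipodal_coloring (@toroidal_grid r s) g ->
  #|[set v | g v %/ c == b]| <= 2.
Proof.
move=> odd_r odd_s c_gt0 c_lt gA; rewrite leqNgt; apply/negP.
move=> /card_gt2P[u [v [w [[]]]]]; rewrite !inE.
move=> /eqP bu /eqP bv /eqP bw [uv vw wu].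
have sep x y : x != y -> diameter (@toroidal_grid r s)
    <= `|g x - g y| + gdist (@toroidal_grid r s) x y.
  rewrite addnC -leq_subLR => xy.
  by have /forallP/(_ x)/forallP/(_ y)/implyP/(_ xy) := gA.
have uw : u != w by rewrite eq_sym.
have := sep _ _ uv; have := sep _ _ vw; have := sep _ _ uw.
have := toroidal_gdist_triangle_perimeter r s u v w.
have := toroidal_diameter_ge r s (odd_gt0 odd_r) (odd_gt0 odd_s).
have block x : g x %/ c = b -> b * c <= g x < b * c + c.
  move=> <-; rewrite {2 3}(divn_eq (g x) c) leq_addr ltn_add2l ltn_mod.
  by rewrite c_gt0.
by move: (block _ bu) (block _ bv) (block _ bw); lia.
Qed.

(** * The span *)

Local Open Scope ring_scope.

Theorem theorem4p7 (r s : nat) (hr : (3 <= r)%N) (hs : (3 <= s)%N)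
    (odd_r : odd r) (odd_s : odd s) :
  (Num.ceil ((r%:R + s%:R - 6%:R) / 4%:R : rat))%:~R
    * ((r%:R * s%:R - 1) / 2%:R)
  <= (antipodal_number (@toroidal_grid r s))%:R :> rat.
Proof.
pose c := (uphalf (r + s - 6)./2)%N; pose m := ((r * s)./2)%N.
have rs_odd : (r * s = 2 * m + 1)%N.
  by rewrite -[LHS]odd_double_half oddM odd_r odd_s -mul2n addnC.
have ceil_le : Num.ceil ((r%:R + s%:R - 6%:R) / 4%:R : rat) <= c%:Z.
  rewrite ceil_le_int -pmulrn ler_pdivrMr // lerBlDr.
  rewrite -natrD -natrM -natrD ler_nat.
  by rewrite /c; lia.
have half_rs : (r%:R * s%:R - 1) / 2%:R = m%:R :> rat.
  by rewrite -natrM rs_odd natrD addrK natrM mulrAC mulfV // mul1r.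
suff span_ge : (c * m <= antipodal_number (@toroidal_grid r s))%N.
  rewrite half_rs; apply: le_trans (_ : (c * m)%:R <= _).
    by rewrite natrM ler_wpM2r ?ler0n // (pmulrn _ c) ler_int.
  by rewrite ler_nat.
have [[g gA <-] _] := antipodal_numberP (@toroidal_grid r s).
(* For [c = 0], that is [r = s = 3], there are no blocks. *)
have [->|c_gt0] := posnP c; first by rewrite mul0n.
rewrite leqNgt; apply/negP => span_lt.
have sparse b : (#|[set v | g v %/ c == b]| <= 2)%N.
  by apply: antipodal_coloring_sparse gA => //; rewrite /c; lia.
have g_lt v : (g v < m * c)%N.
  by rewrite mulnC; apply: leq_ltn_trans span_lt; apply: leq_bigmax.
have := card_le_of_sparse_blocks _ _ _ _ _ sparse g_lt.
by rewrite card_prod !card_ord rs_odd mulnC addn1 ltnn.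
Qed.
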